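(* Let $n,s\ge1$ and $\mathbf{M}=\begin{pmatrix}\mathbf{A}&\mathbf{B}\\\mathbf{C}&\mathbf{D}\end{pmatrix}$ with $\mathbf{A}\in\mathbb{C}^{n\times n}$, $\mathbf{B}\in\mathbb{C}^{n\times s}$, $\mathbf{C}\in\mathbb{C}^{s\times n}$, $\mathbf{D}\in\mathbb{C}^{s\times s}$. Let $\mathrm{m}(x)=\sum_{k=0}^{d}m_kx^k\in\mathbb{C}[x]$ be a polynomial of degree $d>0$ with $\mathrm{m}(\mathbf{M})=\mathbf{0}$, and let $\mathcal{K}(\lambda)\in(\mathbb{C}[\lambda])^{s\times s}$ be the lower right $s\times s$ block of $$\mathrm{p}(\lambda\mathbf{I},\mathbf{M};\mathrm{m})=\sum_{k=1}^{d}m_k\sum_{i=1}^{k}\lambda^{i-1}\mathbf{M}^{k-i}\in(\mathbb{C}[\lambda])^{(n+s)\times(n+s)}.$$ Then $$\sigma(\mathbf{A})=\sigma(\mathbf{M})-\varrho^s\left(\mathrm{m}(\lambda)\right)+\varrho\left(\det(\mathcal{K}(\lambda))\right).$$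
   Context: For a nonzero polynomial $g(\lambda)$, $\varrho(g)$ is the multiset of its complex roots (counted with multiplicity); $\varrho^s(g)$ is the multiset obtained by multiplying the multiplicity of each distinct element of $\varrho(g)$ by $s$. The spectrum of a square complex matrix $\mathbf{X}$ is the multiset $\sigma(\mathbf{X})=\varrho(\det(\lambda\mathbf{I}-\mathbf{X}))$. Sums and differences of multisets are taken multiplicity-wise (as integer-valued multiplicity functions, so intermediate multiplicities may be negative). *)

(* Defs.v *)
From HB Require Import structures.
From mathcomp Require Export all_boot all_order all_algebra.
From mathcomp Require Export complex reals.

Set Implicit Arguments.
Unset Strict Implicit.
Unset Printing Implicit Defensive.

Import Order.TTheory GRing.Theory Num.Theory.
Local Open Scope ring_scope.

(* Multisets are given by their multiplicity functions, with values in int so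
   that differences are taken multiplicity-wise, without truncation. *)
Definition zmultiset (F : Type) := F -> int.

Section Multisets.
Variable F : fieldType.

(* Meaningful only for g != 0. *)
Definition roots_mset (g : {poly F}) : zmultiset F := fun x => (mup x g)%:Z.

Definition roots_mset_scaled (s : nat) (g : {poly F}) : zmultiset F :=
  fun x => s%:Z * roots_mset g x.

(* [char_poly X] is det (lambda I - X). *)
Definition spectrum (n : nat) (X : 'M[F]_n) : zmultiset F :=
  roots_mset (char_poly X).

End Multisets.

Section MatrixPolynomials.
Variables (F : fieldType) (n : nat).

(* Same as [horner_mx], which is restricted to sizes of the form [n'.+1]. *)
Definition poly_mx_eval (m : {poly F}) (M : 'M[F]_n) : 'M[F]_n :=
  \sum_(k < size m) m`_k *: M ^+ k.

(* The sum of m_k lambda^(i-1) M^(k-i) over 1 <= i <= k <= d, where d is the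
   degree of m; lambda is the polynomial variable 'X. *)
Definition p_mx (m : {poly F}) (M : 'M[F]_n) : 'M[{poly F}]_n :=
  \sum_(1 <= k < size m)
    (m`_k)%:P *: \sum_(1 <= i < k.+1) 'X^(i - 1) *: map_mx polyC (M ^+ (k - i)).

End MatrixPolynomials.

(* Main.v *)
(** Since [m(M) = 0], telescoping gives [(X I - M) P = m(X) I] for [P = p_mx m M].
    Replacing the first block column of [P] by that of the identity,
    [[X I - A, -B; -C, X I - D] * [I, P12; 0, K] = [X I - A, 0; -C, m(X) I]],
    and taking determinants, [chi_M * det K = chi_A * m ^ s]. *)
Require Import Defs.

Import Order.TTheory GRing.Theory Num.Theory.
Local Open Scope ring_scope.
Local Open Scope complex_scope.

(** Matrix form of the factorization of x^k - y^k by x - y: each summand times ['X I - M] is a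
    difference of consecutive terms [f i]. *)
Lemma char_poly_mx_geometric {F : fieldType} {n : nat} (M : 'M[F]_n) (k : nat) :
  char_poly_mx M *m
    (\sum_(1 <= i < k.+1) 'X^(i - 1) *: map_mx polyC (M ^+ (k - i))) =
  ('X^k)%:M - map_mx polyC (M ^+ k).
Proof.
pose f i : 'M[{poly F}]_n := 'X^i *: map_mx polyC (M ^+ (k - i)).
have -> : ('X^k)%:M - map_mx polyC (M ^+ k) = f k - f 0%N.
  by rewrite /f subnn subn0 !expr0 scale1r map_mx1 scalemx1.
rewrite -telescope_sumr // big_add1 /= mulmx_sumr; apply: eq_big_nat => i /= ltik.
rewrite /f subn1 /= -scalemxAr mulmxBl mul_scalar_mx scalerBr scalerA -exprSr.
(* The bound [i < k] keeps this natural-number subtraction from truncating. *)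
have -> : (k - i = (k - i.+1).+1)%N by rewrite subnSK.
by rewrite (exprS M) -map_mxM.
Qed.

(** Remainder theorem for matrices, with [p_mx m M] as the quotient: the geometric identities are
    combined with weights [m_k]. *)
Lemma char_poly_mx_mul_p_mx {F : fieldType} {n : nat} (m : {poly F})
    (M : 'M[F]_n) :
  char_poly_mx M *m p_mx m M = m%:M - map_mx polyC (poly_mx_eval m M).
Proof.
rewrite /p_mx /poly_mx_eval mulmx_sumr.
have -> : m%:M = \sum_(0 <= k < size m) (m`_k)%:P *: ('X^k)%:M :> 'M[{poly F}]_n.
  rewrite -[in LHS](coefK m) poly_def big_mkord raddf_sum /=.
  by apply: eq_bigr => k _; rewrite -mul_polyC -scale_scalar_mx.
rewrite -(big_mkord xpredT (fun k => m`_k *: M ^+ k)) raddf_sum /= -sumrB.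
under eq_bigr do rewrite -scalemxAr char_poly_mx_geometric.
under [RHS]eq_bigr do rewrite map_mxZ -scalerBr.
(* The right-hand sum has an extra term at k = 0, which vanishes because ['X^0 I] and [M ^+ 0] are
   both the identity. *)
have [->|m_gt0] := posnP (size m); first by rewrite !big_geq.
by rewrite [RHS]big_ltn // !expr0 map_mx1 subrr scaler0 add0r.
Qed.

Lemma char_poly_mx_block {F : fieldType} {n s : nat} (A : 'M[F]_n)
    (B : 'M[F]_(n, s)) (C : 'M[F]_(s, n)) (D : 'M[F]_s) :
  char_poly_mx (block_mx A B C D) =
  block_mx (char_poly_mx A) (- map_mx polyC B)
           (- map_mx polyC C) (char_poly_mx D).
Proof.
by rewrite /char_poly_mx map_block_mx scalar_mx_block opp_block_mx add_block_mx
           !add0r.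
Qed.

Lemma char_poly_block_mul_det {F : fieldType} {n s : nat} (A : 'M[F]_n)
    (B : 'M[F]_(n, s)) (C : 'M[F]_(s, n)) (D : 'M[F]_s) (m : {poly F}) :
  let M := block_mx A B C D in
  poly_mx_eval m M = 0 ->
  char_poly M * \det (drsubmx (p_mx m M)) = char_poly A * m ^+ s.
Proof.
move=> M mM0; have := char_poly_mx_mul_p_mx m M.
rewrite mM0 map_mx0 subr0 -{1}(submxK (p_mx m M)) char_poly_mx_block mulmx_block.
(* Only the right block column of the product is kept; it is the column that [Q] shares with
   [p_mx m M]. *)
rewrite scalar_mx_block => /eq_block_mx[_ eq_ur _ eq_dr].
set Q := block_mx 1%:M (ursubmx (p_mx m M)) 0 (drsubmx (p_mx m M)).
have -> : \det (drsubmx (p_mx m M)) = \det Q by rewrite det_ublock det1 mul1r.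
rewrite -det_mulmx char_poly_mx_block mulmx_block eq_ur eq_dr !mulmx1 !mulmx0.
by rewrite !addr0 det_lblock det_scalar.
Qed.

Lemma mupX {F : fieldType} (x : F) (p : {poly F}) (k : nat) :
  p != 0 -> mup x (p ^+ k) = (k * mup x p)%N.
Proof.
move=> p_neq0; elim: k => [|k IHk].
  by rewrite expr0 mupNroot ?rootC ?oner_eq0.
by rewrite exprS mupM ?expf_neq0 // IHk mulSn.
Qed.

Theorem corollary5 (R : realType) (n s : nat) (n_gt0 : (0 < n)%N)
    (s_gt0 : (0 < s)%N)
    (A : 'M[R[i]]_(n, n)) (B : 'M[R[i]]_(n, s))
    (C : 'M[R[i]]_(s, n)) (D : 'M[R[i]]_(s, s))
    (d : nat) (m : {poly R[i]}) :
  let M : 'M[R[i]]_(n + s) := block_mx A B C D in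
  let K : 'M[{poly R[i]}]_s := drsubmx (p_mx m M) in
  size m = d.+1 -> (0 < d)%N ->
  poly_mx_eval m M = 0 ->
  \det K != 0 /\
  (forall x : R[i],
     spectrum A x =
       spectrum M x - roots_mset_scaled s m x + roots_mset (\det K) x).
Proof.
move=> M K size_m d_gt0 mM0.
have chi_eq : char_poly M * \det K = char_poly A * m ^+ s.
  exact: char_poly_block_mul_det.
have m_neq0 : m != 0 by rewrite -size_poly_eq0 size_m.
have chi_neq0 k (X : 'M[R[i]]_k) : char_poly X != 0.
  by rewrite monic_neq0 ?char_poly_monic.
(* [char_poly A] is monic and [m] is nonzero, so the right side of [chi_eq] is nonzero and no factor
   on the left can vanish. *)
have detK_neq0 : \det K != 0.
  have : char_poly M * \det K != 0 by rewrite chi_eq mulf_neq0 ?expf_neq0.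
  by rewrite mulf_eq0 negb_or => /andP[].
(* Multiplicities at [x] turn the product identity into a sum in nat, moved to int before
   subtracting. *)
split=> // x; have /(congr1 (mup x)) := chi_eq.
rewrite !mupM ?expf_neq0 // mupX // => /(congr1 Posz).
rewrite !PoszD PoszM /spectrum /roots_mset_scaled /roots_mset => mup_eq.
by rewrite addrAC mup_eq addrK.
Qed.
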